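(* Fix $p\in(0,1)$. For each integer $\nu\ge 2$ let $n:=\binom{\nu}{2}$ and let $\pi(x)=p^{S(x)}(1-p)^{n-S(x)}$ for $x\in\{0,1\}^n$ be the Erdős–Rényi random graph model on $\nu$ vertices with parameter $p$. Then the lazy random walk Metropolis chain for this model (as $\nu\to\infty$) has cutoff at $\max\{p,1-p\}\,n\log n$ with a window of size $n$.
   Context: For $x\in\{0,1\}^n$, $S(x)=\sum_{i=1}^n x_i$. Coordinates of $\{0,1\}^n$ are identified with the $n=\binom{\nu}{2}$ potential edges of a simple graph on $\nu$ vertices. Two states are neighbors if they differ in exactly one coordinate. Lazy random walk Metropolis chain for a positive distribution $\pi$ on $\{0,1\}^n$: at each step, flip an independent fair coin. If heads, stay at the current state $x$. If tails, choose one of the $n$ neighbors $y$ of $x$ uniformly at random, move to $y$ with probability $\min(1,\pi(y)/\pi(x))$, and otherwise stay at $x$. Its transition matrix is denoted $P$. Total variation distance: $\|\mu-\nu\|=\max_A(\mu(A)-\nu(A))$. For the chain on $\{0,1\}^n$, $d_n(t)=\max_x\|P^t(x,\cdot)-\pi\|$ for $t=0,1,2,\dots$ (non-integer times are rounded to integers, e.g. down). A sequence of chains has cutoff at $s_n$ with window size $w_n$ if $w_n=o(s_n)$, $\lim_{\alpha\to\infty}\liminf_{n\to\infty}d_n(s_n-\alpha w_n)=1$, and $\lim_{\alpha\to\infty}\limsup_{n\to\infty}d_n(s_n+\alpha w_n)=0$; here $n$ runs through the values $\binom{\nu}{2}$, $\nu\to\infty$. *)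

(* Defs.v *)
From HB Require Import structures.
From mathcomp Require Import all_boot all_order all_algebra.
From mathcomp Require Import all_classical all_reals all_analysis.
Set Implicit Arguments.
Unset Strict Implicit.
Unset Printing Implicit Defensive.
Import Order.TTheory GRing.Theory Num.Theory.
Import numFieldNormedType.Exports.
Local Open Scope ring_scope.
Local Open Scope classical_set_scope.

(* The entry for (x, y) sits at position (enum_rank x, enum_rank y). *)
Definition transition_mx (R : realType) (T : finType) (K : T -> T -> R)
    : 'M[R]_#|T| :=
  \matrix_(i, j) K (enum_val i) (enum_val j).

Definition transition_pow (R : realType) (T : finType) (P : 'M[R]_#|T|)
    (t : nat) (x y : T) : R :=
  (P ^+ t) (enum_rank x) (enum_rank y).

(* The default value 0 of the maximum is the value at the empty event. *)
Definition tv_dist (R : realType) (T : finType) (mu nu : T -> R) : R :=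
  \big[Num.max/0]_(A : {set T}) (\sum_(x in A) mu x - \sum_(x in A) nu x).

(* The default value 0 is harmless: the distances are nonnegative. *)
Definition mixing_dist (R : realType) (T : finType) (P : 'M[R]_#|T|)
    (pi : T -> R) (t : nat) : R :=
  \big[Num.max/0]_(x : T) tv_dist (transition_pow P t x) pi.

(* [d k t] is the distance to equilibrium of the k-th chain at time t.
   Real times are rounded down, negative ones to 0.  The limits in k are taken
   in the extended reals, where liminf and limsup always exist. *)
Definition has_cutoff (R : realType) (d : nat -> nat -> R) (s w : nat -> R)
    : Prop :=
  [/\ (w : nat -> R^o) =o_\oo (s : nat -> R^o),
      (fun alpha : R => limn_einf
         (fun k => (d k (Num.truncn (s k - alpha * w k)))%:E))
        @ +oo --> 1%:E
    & (fun alpha : R => limn_esup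
         (fun k => (d k (Num.truncn (s k + alpha * w k)))%:E))
        @ +oo --> 0%:E].

Definition neighbors (I : finType) (x : {ffun I -> bool})
    : {set {ffun I -> bool}} :=
  [set y : {ffun I -> bool} | #|[set i | x i != y i]| == 1%N]%SET.

Definition accept_prob (R : realType) (T : finType) (pi : T -> R) (x y : T)
    : R :=
  Num.min 1 (pi y / pi x).

(* Probability to move from x to y: stay with probability 1/2; otherwise
   propose a uniform neighbor z, and end at z with probability
   [accept_prob pi x z], at x with the remaining probability. *)
Definition lazy_metropolis (R : realType) (I : finType)
    (pi : {ffun I -> bool} -> R) (x y : {ffun I -> bool}) : R :=
  2^-1 * (y == x)%:R
  + 2^-1 * \sum_(z in neighbors x) #|I|%:R^-1 *
      (accept_prob pi x z * (y == z)%:R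
       + (1 - accept_prob pi x z) * (y == x)%:R).

Definition metropolis_dist (R : realType) (I : finType)
    (pi : {ffun I -> bool} -> R) (t : nat) : R :=
  mixing_dist (transition_mx (lazy_metropolis pi)) pi t.

(* A graph on the vertex set 'I_nu is identified with the indicator function
   of its edge set, an element of {ffun potential_edge nu -> bool}. *)

Definition potential_edge (nu : nat) : finType :=
  {e : {set 'I_nu} | #|e| == 2%N}.

Lemma card_potential_edge (nu : nat) : #|potential_edge nu| = 'C(nu, 2).
Proof.
rewrite card_sig -[in RHS](card_ord nu) -card_draws cardsE.
by apply: eq_card => e.
Qed.

Definition edge_count (nu : nat) (x : {ffun potential_edge nu -> bool}) : nat :=
  \sum_(e : potential_edge nu) x e.

Definition erdos_renyi (R : realType) (p : R) (nu : nat)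
    (x : {ffun potential_edge nu -> bool}) : R :=
  p ^+ edge_count x * (1 - p) ^+ ('C(nu, 2) - edge_count x).

(* Main.v *)
Require Import Defs.
From mathcomp Require Import all_boot all_order all_algebra.
From mathcomp Require Import all_classical all_reals all_analysis.
From mathcomp Require Import ring lra.
Import Order.TTheory GRing.Theory Num.Theory.
Import numFieldNormedType.Exports.
Local Open Scope ring_scope.
Set Implicit Arguments.
Unset Strict Implicit.
Unset Printing Implicit Defensive.

(** The Erdős–Rényi law makes the edges independent Bernoulli(p) variables, and
    a Metropolis step changes one edge at a time with an acceptance probability
    that depends on that edge alone.  Put m = max(p, 1-p) and let n be the
    number of edges.  The identity

      min(1, mu(1-b) / mu(b)) * ((1 - b - p) - (b - p)) = - (b - p) / m

    for b = 0, 1, where mu is the Bernoulli(p) law of one edge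
    [accept_centered], makes every product walsh A x = prod_(i in A) (x_i - p)
    an eigenfunction of the chain, with eigenvalue 1 - |A| / (2 m n)
    [lazy_metropolis_walsh].  These 2^n orthogonal functions diagonalize the
    kernel, so everything about P^t is explicit [transition_pow_spectral].

    Upper bound.  By reversibility the chi-square distance of P^t(x, .) to pi is
    P^(2t)(x, x) / pi(x) - 1.  In the spectral expansion each nonempty A
    contributes at most (exp(- t / (m n)) / (p (1-p)))^|A|, and the sum over A
    is a binomial sum, hence the bound
    exp(n exp(- t / (m n)) / (p (1-p))) - 1 [chi2_transition_pow_le].  At
    t = m n log n + alpha n the exponent is of order exp(- alpha / m),
    uniformly in n, and the total variation distance is at most the square root
    of the chi-square distance.

    Lower bound.  Start from the complete graph and observe
    f(y) = sum_i (y_i - p), which is an eigenfunction for the eigenvalue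
    1 - 1/(2 m n).  Its mean at time t is n (1-p) (1 - 1/(2 m n))^t, of order
    sqrt(n) exp(alpha / (2 m)) at t = m n log n - alpha n.  Its variance is at
    most n both at equilibrium and at time t: two coordinates are negatively
    correlated, because the eigenvalue of a pair is at most the square of that
    of a singleton.  Chebyshev's inequality for both laws separates them by the
    event that f exceeds half its mean [metropolis_dist_ge_second_moment].

    Both bounds hold for all large n with constants that depend on p only, so
    they pass to the lower and upper limits in n, and then alpha tends to
    infinity. *)

(** * Powers of a finite transition matrix *)

Section TransitionPowers.
Context (R : realType) (T : finType).
Implicit Types (K : T -> T -> R) (P : 'M[R]_#|T|).

Lemma transition_pow0 P x y : transition_pow P 0 x y = (x == y)%:R.
Proof. by rewrite /transition_pow expr0 mxE (inj_eq enum_rank_inj). Qed.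

Lemma transition_powD P s t x y :
  transition_pow P (s + t) x y =
  \sum_z transition_pow P s x z * transition_pow P t z y.
Proof.
rewrite /transition_pow exprD mxE (reindex (@enum_rank T)) //=.
by exists enum_val => i _; rewrite ?enum_rankK ?enum_valK.
Qed.

Lemma transition_powS K t x y :
  transition_pow (transition_mx K) t.+1 x y =
  \sum_z K x z * transition_pow (transition_mx K) t z y.
Proof.
rewrite -add1n transition_powD; apply: eq_bigr => z _.
by rewrite {1}/transition_pow expr1 mxE !enum_rankK.
Qed.

Lemma transition_pow_ge0 K t x y : (forall a b, 0 <= K a b) ->
  0 <= transition_pow (transition_mx K) t x y.
Proof.
move=> K_ge0; elim: t x => [|t IHt] x; first by rewrite transition_pow0 ler0n.
by rewrite transition_powS sumr_ge0 // => z _; rewrite mulr_ge0.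
Qed.

Lemma transition_pow_eigen K (f : T -> R) l t x :
    (forall a, \sum_b K a b * f b = l * f a) ->
  \sum_y transition_pow (transition_mx K) t x y * f y = l ^+ t * f x.
Proof.
move=> Kf; elim: t x => [|t IHt] x.
  rewrite (bigD1 x) //= transition_pow0 eqxx expr0 big1 ?addr0 // => y yx.
  by rewrite transition_pow0 eq_sym (negbTE yx) mul0r.
under eq_bigr do rewrite transition_powS mulr_suml.
rewrite exchange_big /=.
under eq_bigr => z _.
  under eq_bigr do rewrite -mulrA.
  rewrite -mulr_sumr IHt mulrCA; over.
by rewrite -mulr_sumr Kf exprSr mulrA.
Qed.

End TransitionPowers.

(** * Total variation distance and finite Chebyshev inequality *)

Section TotalVariation.
Context (R : realType) (T : finType).
Implicit Types mu nu : T -> R.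

Lemma event_le_tv_dist mu nu (A : {set T}) :
  \sum_(x in A) mu x - \sum_(x in A) nu x <= tv_dist mu nu.
Proof.
exact: (le_bigmax _ (fun A : {set T} =>
  \sum_(x in A) mu x - \sum_(x in A) nu x)).
Qed.

Lemma sum_event_le mu (A : {set T}) :
  (forall x, 0 <= mu x) -> \sum_(x in A) mu x <= \sum_x mu x.
Proof.
move=> mu_ge0; rewrite [leRHS](bigID (mem A)) /= lerDl.
by apply: sumr_ge0.
Qed.

Lemma tv_dist_le1 mu nu : (forall x, 0 <= mu x) -> (forall x, 0 <= nu x) ->
  \sum_x mu x = 1 -> tv_dist mu nu <= 1.
Proof.
move=> mu_ge0 nu_ge0 mu1; apply: bigmax_le => // A _.
rewrite -mu1 lerBlDr (le_trans (sum_event_le A mu_ge0)) //.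
by rewrite lerDl sumr_ge0.
Qed.

(** Writing u = mu / nu - 1, the inequality u <= (u ^ 2 / s + s) / 2 is
    integrated against nu over an event; this gives Cauchy-Schwarz with no
    square root, s being any upper bound of the chi-square norm. *)
Lemma tv_dist_le_chi2 mu nu s : 0 < s -> (forall x, 0 < nu x) ->
    \sum_x nu x = 1 -> \sum_x nu x * (mu x / nu x - 1) ^+ 2 <= s ^+ 2 ->
  tv_dist mu nu <= s.
Proof.
move=> s_gt0 nu_gt0 nu1 chi2; apply: bigmax_le => [|A _]; first exact: ltW.
pose g x := nu x * ((mu x / nu x - 1) ^+ 2 / s + s) / 2.
have g_ge0 x : 0 <= g x.
  by rewrite divr_ge0 ?mulr_ge0 ?addr_ge0 ?divr_ge0 ?sqr_ge0 ?ltW.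
rewrite -sumrB (@le_trans _ _ (\sum_x g x)) //.
  apply: le_trans (sum_event_le A g_ge0); apply: ler_sum => x _.
  have -> : mu x - nu x = nu x * (mu x / nu x - 1).
    by field; rewrite gt_eqF.
  rewrite /g -mulrA; apply: ler_wpM2l; first exact: ltW.
  set u := _ - 1; have := sqr_ge0 (u - s); rewrite -subr_ge0 => h.
  have -> : (u ^+ 2 / s + s) / 2 - u = (u - s) ^+ 2 / (2 * s).
    by field; rewrite gt_eqF.
  by rewrite divr_ge0 ?sqr_ge0 // mulr_ge0 ?ltW.
have -> : \sum_x g x =
    ((\sum_x nu x * (mu x / nu x - 1) ^+ 2) / s + s * \sum_x nu x) / 2.
  rewrite mulr_suml mulr_sumr -big_split mulr_suml /=.
  by apply: eq_bigr => x _; rewrite /g; ring.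
rewrite nu1 ler_pdivrMr // mulr1 mulr2n mulrDr mulr1 lerD2r.
by rewrite ler_pdivrMr // -expr2.
Qed.

Lemma chebyshev_sum mu (f : T -> R) a b (A : {set T}) :
    0 < b -> (forall x, 0 <= mu x) -> (forall x, x \in A -> b <= `|f x - a|) ->
  \sum_(x in A) mu x <= (\sum_x mu x * (f x - a) ^+ 2) / b ^+ 2.
Proof.
move=> b_gt0 mu_ge0 Ab; rewrite ler_pdivlMr ?exprn_gt0 // mulr_suml.
rewrite [leRHS](bigID (mem A)) /= -[leLHS]addr0.
apply: lerD; last by apply: sumr_ge0 => x _; rewrite mulr_ge0 ?sqr_ge0.
apply: ler_sum => x /Ab bx; apply: ler_wpM2l => //.
by rewrite -[leRHS]real_normK ?num_real // lerXn2r // nnegrE ltW.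
Qed.

End TotalVariation.

(** * Spectrum of the Metropolis chain of a product Bernoulli law *)

Section ProductBernoulli.
Context (R : realType) (p : R) (p_gt0 : 0 < p) (p_lt1 : p < 1) (I : finType).
Implicit Types (x y z : {ffun I -> bool}) (A : {set I}) (i : I).

Definition bernoulli (b : bool) : R := if b then p else 1 - p.

Definition bernoulli_prod x : R := \prod_i bernoulli (x i).

Definition centered (b : bool) : R := b%:R - p.

(** The Fourier-Walsh basis adapted to the bias p, not normalized: the function
    of A has squared norm (p * (1 - p)) ^ #|A| under the product law. *)
Definition walsh A x : R := \prod_(i in A) centered (x i).

Definition flip i x : {ffun I -> bool} := [ffun j => (j == i) (+) x j].

(** The rate at which one coordinate relaxes.  A lazy accept-reject move of a
    coordinate amounts to resampling it from its law with probability
    1 / (2 * max p (1 - p)), and a given coordinate is proposed once in #|I|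
    steps on average. *)
Definition relax_rate : R := (2 * Num.max p (1 - p) * #|I|%:R)^-1.

Definition walsh_eigenvalue A : R := 1 - #|A|%:R * relax_rate.

Local Notation K := (lazy_metropolis bernoulli_prod).
Local Notation Pt := (transition_pow (transition_mx K)).

Lemma bernoulli_gt0 b : 0 < bernoulli b.
Proof. by case: b; rewrite /= ?subr_gt0. Qed.

Lemma bernoulli_prod_gt0 x : 0 < bernoulli_prod x.
Proof. by apply: prodr_gt0 => i _; apply: bernoulli_gt0. Qed.

Lemma sum_bernoulli_prod : \sum_x bernoulli_prod x = 1.
Proof.
rewrite -(bigA_distr_bigA (fun=> bernoulli)) big1 // => i _.
by rewrite big_bool /=; ring.
Qed.

Lemma neighbors_flip x : neighbors x = [set flip i x | i : I]%SET.
Proof.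
apply/setP => y; rewrite inE; apply/cards1P/imsetP => [[i dxy]|[i _ ->]].
  exists i => //; apply/ffunP => j; rewrite ffunE.
  by move/setP/(_ j): dxy; rewrite !inE => <-; case: (x j); case: (y j).
exists i; apply/setP => j; rewrite !inE ffunE.
by case: (x j); case: (j == i).
Qed.

Lemma flip_inj x : injective (flip^~ x).
Proof.
move=> i j /ffunP/(_ i); rewrite !ffunE eqxx => /addIb.
by move/esym/eqP.
Qed.

Lemma bernoulli_prod_flip i x :
  bernoulli_prod (flip i x) / bernoulli_prod x =
  bernoulli (~~ x i) / bernoulli (x i).
Proof.
rewrite /bernoulli_prod (bigD1 i) //= [in X in _ / X](bigD1 i) //= ffunE eqxx.
rewrite (eq_bigr (fun j => bernoulli (x j))) => [|j ji]; last first.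
  by rewrite ffunE (negbTE ji).
rewrite -mulf_div divff ?mulr1 //.
by apply/lt0r_neq0/prodr_gt0 => j _; apply: bernoulli_gt0.
Qed.

Lemma lazy_metropolis_sum (f : {ffun I -> bool} -> R) x : (0 < #|I|)%N ->
  \sum_y K x y * f y =
  f x + (2 * #|I|%:R)^-1 * \sum_i
    Num.min 1 (bernoulli (~~ x i) / bernoulli (x i)) * (f (flip i x) - f x).
Proof.
move=> I_gt0; have n_neq0 : #|I|%:R != 0 :> R by rewrite pnatr_eq0 -lt0n.
have sum_dirac u : \sum_y (y == u)%:R * f y = f u.
  rewrite (bigD1 u) //= eqxx mul1r big1 ?addr0 // => y /negbTE->.
  by rewrite mul0r.
rewrite /lazy_metropolis.
under eq_bigr do rewrite mulrDl -!mulrA mulr_suml.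
rewrite big_split -!mulr_sumr /= sum_dirac exchange_big /= neighbors_flip.
rewrite big_imset /=; last by move=> i j _ _; apply: flip_inj.
have eqf i : true -> \sum_y #|I|%:R^-1 *
       (accept_prob bernoulli_prod x (flip i x) * (y == flip i x)%:R +
        (1 - accept_prob bernoulli_prod x (flip i x)) * (y == x)%:R) * f y =
    #|I|%:R^-1 * f x + #|I|%:R^-1 *
    (Num.min 1 (bernoulli (~~ x i) / bernoulli (x i)) * (f (flip i x) - f x)).
  move=> _; rewrite /accept_prob bernoulli_prod_flip; set a := Num.min _ _.
  under eq_bigr do rewrite -mulrA mulrDl -!mulrA.
  by rewrite -mulr_sumr big_split -!mulr_sumr /= !sum_dirac; ring.
rewrite (eq_bigr _ eqf) big_split /= sumr_const mulrDr addrA; congr (_ + _).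
  by rewrite -[_ *+ _]mulr_natr; field.
by rewrite -mulr_sumr invfM mulrA.
Qed.

Lemma max_gt0 : 0 < Num.max p (1 - p).
Proof. by rewrite lt_max p_gt0. Qed.

(** The acceptance probability compensates the asymmetry between the two values
    of a coordinate: the expected displacement is proportional to the centered
    value, with the same factor whether the coordinate is set or not. *)
Lemma accept_centered b :
  Num.min 1 (bernoulli (~~ b) / bernoulli b) * (centered (~~ b) - centered b) =
  - (Num.max p (1 - p))^-1 * centered b.
Proof.
have q_gt0 : 0 < 1 - p by rewrite subr_gt0.
have [pq|qp] := leP p (1 - p); rewrite /centered; case: b => /=.
- by rewrite min_l ?ler_pdivlMr ?mul1r //; field; rewrite gt_eqF.
- by rewrite min_r ?ler_pdivrMr ?mul1r //; field; rewrite gt_eqF.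
- by rewrite min_r ?ler_pdivrMr ?mul1r 1?ltW //; field; rewrite gt_eqF.
- by rewrite min_l ?ler_pdivlMr ?mul1r 1?ltW //; field; rewrite !gt_eqF.
Qed.

Lemma centered_sq_le1 b : centered b ^+ 2 <= 1.
Proof.
move: p_gt0 p_lt1; rewrite /centered expr2.
by case: b => /=; nra.
Qed.

Lemma walsh_flip A i x : walsh A (flip i x) - walsh A x =
  if i \in A then
    (centered (~~ x i) - centered (x i)) *
      \prod_(j in A | j != i) centered (x j)
  else 0.
Proof.
case: ifP => iA; last first.
  apply/eqP; rewrite subr_eq0; apply/eqP/eq_bigr => j jA.
  by rewrite ffunE (negbTE (memPn (negbT iA) j jA)).
rewrite /walsh (bigD1 i) //= [X in _ - X](bigD1 i) //= ffunE eqxx.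
rewrite (eq_bigr (fun j => centered (x j))) => [|j /andP[_ /negbTE ji]].
  by rewrite -mulrBl addTb.
by rewrite ffunE ji.
Qed.

(** A flip outside A leaves the product unchanged, and each of the #|A| flips
    inside A multiplies one factor as in [accept_centered], contributing
    - relax_rate each. *)
Lemma lazy_metropolis_walsh A x : (0 < #|I|)%N ->
  \sum_y K x y * walsh A y = walsh_eigenvalue A * walsh A x.
Proof.
move=> I_gt0; have n_neq0 : #|I|%:R != 0 :> R by rewrite pnatr_eq0 -lt0n.
rewrite lazy_metropolis_sum // mulrBl mul1r; congr (_ + _).
rewrite (bigID (mem A)) /= [X in _ + X]big1 ?addr0 => [|i /negbTE iA]; last first.
  by rewrite walsh_flip iA !mulr0.
rewrite mulr_sumr (eq_bigr (fun=> - (relax_rate * walsh A x))) => [|i iA].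
  by rewrite sumr_const -[LHS]mulr_natl; ring.
rewrite walsh_flip iA [X in _ * X]mulrA accept_centered.
rewrite /walsh [in RHS](bigD1 i) //= /relax_rate.
by field; rewrite n_neq0 gt_eqF ?max_gt0.
Qed.

(** Expand the product over the coordinates of
    [x i == y i] / bernoulli (y i) = 1 + (x i - p) * (y i - p) / (p * (1 - p)).
    This is the completeness of the Walsh basis. *)
Lemma dirac_walsh x y :
  (x == y)%:R = bernoulli_prod y *
    \sum_(A : {set I}) walsh A x * walsh A y / (p * (1 - p)) ^+ #|A|.
Proof.
have q_gt0 : 0 < 1 - p by rewrite subr_gt0.
have -> : (x == y)%:R = \prod_i (x i == y i)%:R :> R.
  have [->|xy] := eqVneq x y; first by rewrite big1 // => i; rewrite eqxx.
  have /existsP[i xyi] : [exists i, x i != y i].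
    apply: contraNT xy => /existsPn h; apply/eqP/ffunP => i.
    by apply/eqP; rewrite -[_ == _]negbK.
  by rewrite (bigD1 i) //= (negbTE xyi) mul0r.
rewrite (eq_bigr (fun i => bernoulli (y i) *
   (centered (x i) * centered (y i) / (p * (1 - p)) + 1))) => [|i _].
  rewrite big_split; congr (_ * _); rewrite bigA_distr; apply: eq_bigr => A _.
  rewrite -big_mkcond /= /walsh -!big_split /=.
  by rewrite big_split /= prodr_const exprVn.
by rewrite /centered; case: (x i); case: (y i) => /=; field;
  rewrite !gt_eqF.
Qed.

(** Decompose the indicator of y in the Walsh basis and apply P^t to each
    eigenfunction. *)
Lemma transition_pow_spectral t x y : (0 < #|I|)%N ->
  Pt t x y = bernoulli_prod y * \sum_(A : {set I}) walsh_eigenvalue A ^+ t *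
    (walsh A x * walsh A y / (p * (1 - p)) ^+ #|A|).
Proof.
move=> I_gt0.
have -> : Pt t x y = \sum_z Pt t x z * (z == y)%:R.
  rewrite (bigD1 y) //= eqxx mulr1 big1 ?addr0 // => z /negbTE->.
  by rewrite mulr0.
under eq_bigr do rewrite dirac_walsh mulrCA mulr_sumr.
rewrite -mulr_sumr exchange_big; congr (_ * _); apply: eq_bigr => A _ /=.
under eq_bigr do rewrite -[_ / _]mulrA [Pt t x _ * _]mulrA.
rewrite -mulr_suml (transition_pow_eigen _ _ (l := walsh_eigenvalue A)).
  by rewrite !mulrA.
by move=> z; apply: lazy_metropolis_walsh.
Qed.

Lemma transition_pow_reversible t x y : (0 < #|I|)%N ->
  bernoulli_prod x * Pt t x y = bernoulli_prod y * Pt t y x.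
Proof.
move=> I_gt0; rewrite !transition_pow_spectral // mulrCA; do 2!congr (_ * _).
by apply: eq_bigr => A _; rewrite [walsh A x * _]mulrC.
Qed.

Lemma lazy_metropolis_ge0 x y : 0 <= K x y.
Proof.
rewrite addr_ge0 ?mulr_ge0 ?invr_ge0 ?ler0n // sumr_ge0 // => z _.
rewrite mulr_ge0 ?invr_ge0 ?ler0n // addr_ge0 // mulr_ge0 ?ler0n //.
  by rewrite le_min ler01 divr_ge0 // ltW ?bernoulli_prod_gt0.
by rewrite subr_ge0 ge_min lexx.
Qed.

Lemma metropolis_pow_ge0 t x y : 0 <= Pt t x y.
Proof. exact: transition_pow_ge0 lazy_metropolis_ge0. Qed.

Lemma sum_transition_pow_walsh t x A : (0 < #|I|)%N ->
  \sum_y Pt t x y * walsh A y = walsh_eigenvalue A ^+ t * walsh A x.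
Proof.
by move=> I_gt0; apply: transition_pow_eigen => z; apply: lazy_metropolis_walsh.
Qed.

Lemma sum_transition_pow t x : (0 < #|I|)%N -> \sum_y Pt t x y = 1.
Proof.
move=> I_gt0; have := sum_transition_pow_walsh t x finset.set0 I_gt0.
rewrite /walsh_eigenvalue cards0 mul0r subr0 expr1n mul1r /walsh big_set0 => <-.
by apply: eq_bigr => y _; rewrite big_set0 mulr1.
Qed.

(** The law is stationary by reversibility, so the mean of an eigenfunction is
    multiplied by its eigenvalue, which differs from 1 for nonempty A. *)
Lemma sum_bernoulli_prod_walsh A : (0 < #|I|)%N -> A != finset.set0 ->
  \sum_y bernoulli_prod y * walsh A y = 0.
Proof.
move=> I_gt0 A0; set e := LHS.
(* Stationarity: rewrite 1 as the mass of one step, then reverse the step. *)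
have : e = walsh_eigenvalue A * e.
  rewrite {1}/e.
  under eq_bigr => y _.
    rewrite -[bernoulli_prod y]mulr1 -(sum_transition_pow 1 y I_gt0).
    rewrite mulr_sumr mulr_suml.
    under eq_bigr do rewrite transition_pow_reversible //; over.
  rewrite exchange_big /= /e mulr_sumr; apply: eq_bigr => x _.
  under eq_bigr do rewrite -mulrA.
  by rewrite -mulr_sumr sum_transition_pow_walsh // expr1 mulrCA.
rewrite /walsh_eigenvalue mulrBl mul1r => /eqP.
rewrite -subr_eq0 opprB addrC subrK mulf_eq0 => /orP[|/eqP//].
rewrite mulf_eq0 pnatr_eq0 cards_eq0 (negbTE A0) invr_eq0 /= !mulf_eq0.
by rewrite !pnatr_eq0 (gt_eqF max_gt0) /= eqn0Ngt I_gt0.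
Qed.

(** * Chi-square upper bound *)

(** By reversibility P^t(x, y) ^ 2 / pi(y) = P^t(x, y) P^t(y, x) / pi(x), and
    summing over y gives the return probability P^(2t)(x, x) / pi(x). *)
Lemma chi2_transition_pow t x : (0 < #|I|)%N ->
  \sum_y bernoulli_prod y * (Pt t x y / bernoulli_prod y - 1) ^+ 2 =
  \sum_(A : {set I}) walsh_eigenvalue A ^+ (t + t) *
     (walsh A x ^+ 2 / (p * (1 - p)) ^+ #|A|) - 1.
Proof.
move=> I_gt0; have pi0 y := lt0r_neq0 (bernoulli_prod_gt0 y).
transitivity (Pt (t + t) x x / bernoulli_prod x - 1); last first.
  by rewrite transition_pow_spectral // [X in X / _]mulrC mulfK.
transitivity (\sum_y (Pt t x y * Pt t y x / bernoulli_prod x -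
                      2 * Pt t x y + bernoulli_prod y)).
  apply: eq_bigr => y _; rewrite -(mulKf (pi0 y) (Pt t y x)).
  rewrite -transition_pow_reversible //.
  by field; rewrite !pi0.
rewrite big_split big_split /= sum_bernoulli_prod -mulr_suml -transition_powD.
rewrite sumrN -mulr_sumr sum_transition_pow //; ring.
Qed.

Lemma max_ge_half : 1 <= 2 * Num.max p (1 - p).
Proof.
have : p <= Num.max p (1 - p) by rewrite le_max lexx.
have : 1 - p <= Num.max p (1 - p) by rewrite le_max lexx orbT.
by lra.
Qed.

Lemma relax_rate_ge0 : 0 <= relax_rate.
Proof. by rewrite invr_ge0 mulr_ge0 ?mulr_ge0 ?ler0n // ltW ?max_gt0. Qed.

Lemma card_relax_rate : (0 < #|I|)%N ->
  #|I|%:R * relax_rate = (2 * Num.max p (1 - p))^-1.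
Proof.
move=> I_gt0; have n_neq0 : #|I|%:R != 0 :> R by rewrite pnatr_eq0 -lt0n.
by rewrite /relax_rate; field; rewrite n_neq0 gt_eqF ?max_gt0.
Qed.

Lemma relax_rate_le : (0 < #|I|)%N -> relax_rate <= #|I|%:R^-1.
Proof.
move=> I_gt0; rewrite -[leRHS]mul1r ler_pdivlMr ?ltr0n // mulrC.
rewrite card_relax_rate // invf_le1 ?max_ge_half //.
by rewrite mulr_gt0 ?max_gt0.
Qed.

Lemma walsh_eigenvalue_ge0 A : (0 < #|I|)%N -> 0 <= walsh_eigenvalue A.
Proof.
move=> I_gt0; rewrite subr_ge0 (@le_trans _ _ (#|I|%:R * relax_rate)) //.
  by rewrite ler_wpM2r ?relax_rate_ge0 // ler_nat max_card.
rewrite (@le_trans _ _ (#|I|%:R * #|I|%:R^-1)) //.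
  by rewrite ler_wpM2l ?relax_rate_le.
by rewrite divff // pnatr_eq0 -lt0n.
Qed.

Lemma sum_subsets_exp (z : R) : \sum_(A : {set I}) z ^+ #|A| = (z + 1) ^+ #|I|.
Proof.
rewrite -prodr_const (eq_bigl xpredT) // bigA_distr; apply: eq_bigr => A _.
by rewrite -big_mkcond prodr_const.
Qed.

(** The eigenvalues lie in [0, 1] and 1 - a <= exp (- a), so the spectral sum is
    dominated by sum_A z ^ #|A| = (1 + z) ^ #|I| <= exp (#|I| z). *)
Lemma chi2_transition_pow_le t x : (0 < #|I|)%N ->
  \sum_y bernoulli_prod y * (Pt t x y / bernoulli_prod y - 1) ^+ 2 <=
  expR (#|I|%:R * (expR (- (2 * t%:R * relax_rate)) / (p * (1 - p)))) - 1.
Proof.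
move=> I_gt0; rewrite chi2_transition_pow // lerD2r; set z := _ / _.
have q_gt0 : 0 < 1 - p by rewrite subr_gt0.
have pq_gt0 : 0 < p * (1 - p) by rewrite mulr_gt0.
have z_ge0 : 0 <= z by rewrite divr_ge0 ?expR_ge0 // ltW.
rewrite expRM_natl (@le_trans _ _ ((z + 1) ^+ #|I|)) //; last first.
  by rewrite lerXn2r ?nnegrE ?expR_ge0 ?addr_ge0 // addrC expR_ge1Dx.
rewrite -sum_subsets_exp; apply: ler_sum => A _.
rewrite expr_div_n -expRM_natl ler_pM ?exprn_ge0 ?walsh_eigenvalue_ge0 //.
- by rewrite divr_ge0 ?sqr_ge0 ?exprn_ge0 ?ltW.
- rewrite (@le_trans _ _ (expR (- (#|A|%:R * relax_rate)) ^+ (t + t))) //.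
    rewrite lerXn2r ?nnegrE ?expR_ge0 ?walsh_eigenvalue_ge0 //.
    exact: expR_ge1Dx.
  by rewrite -expRM_natl natrD ler_expR; lra.
rewrite ler_pdivrMr ?exprn_gt0 // mulVf ?gt_eqF ?exprn_gt0 //.
rewrite /walsh -prodrXl prodr_ile1 // => i _.
by rewrite sqr_ge0 centered_sq_le1.
Qed.

Lemma metropolis_dist_le_chi2 t (s : R) : (0 < #|I|)%N -> 0 < s ->
  expR (#|I|%:R * (expR (- (2 * t%:R * relax_rate)) / (p * (1 - p)))) - 1
    <= s ^+ 2 ->
  metropolis_dist bernoulli_prod t <= s.
Proof.
move=> I_gt0 s_gt0 h; apply: bigmax_le => [|x _]; first exact: ltW.
apply: tv_dist_le_chi2 => //; first exact: bernoulli_prod_gt0.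
  exact: sum_bernoulli_prod.
exact: le_trans (chi2_transition_pow_le t x I_gt0) h.
Qed.

Lemma metropolis_dist_ge0 t : 0 <= metropolis_dist bernoulli_prod t.
Proof. exact: bigmax_ge_id. Qed.

Lemma metropolis_dist_le1 t : (0 < #|I|)%N ->
  metropolis_dist bernoulli_prod t <= 1.
Proof.
move=> I_gt0; apply: bigmax_le => // x _; apply: tv_dist_le1.
- exact: metropolis_pow_ge0.
- by move=> y; apply/ltW/bernoulli_prod_gt0.
- exact: sum_transition_pow.
Qed.

(** * Second-moment lower bound *)

Definition centered_sum x : R := \sum_i centered (x i).

Lemma centered_sumE x : centered_sum x = \sum_i walsh [set i]%SET x.
Proof. by apply: eq_bigr => i _; rewrite /walsh big_set1. Qed.

Lemma centered_sum_sq_le x : centered_sum x ^+ 2 <=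
  #|I|%:R + \sum_i \sum_(j | j != i) walsh [set i; j]%SET x.
Proof.
rewrite expr2 {1}/centered_sum mulr_suml.
rewrite -sum1_card natr_sum -big_split; apply: ler_sum => i _ /=.
rewrite /centered_sum (bigD1 i) //= mulrDr mulr_sumr; apply: lerD.
  by rewrite -expr2 centered_sq_le1.
apply: ler_sum => j ji.
rewrite /walsh big_setU1 ?inE 1?eq_sym //= big_set1 //.
Qed.

(** The square expands into its diagonal, at most #|I| since centered values lie
    in [-1, 1], and the Walsh functions of pairs, whose means are explicit both
    at equilibrium and at time t. *)
Lemma second_moment_le (mu : {ffun I -> bool} -> R) :
    (forall y, 0 <= mu y) -> \sum_y mu y = 1 ->
  \sum_y mu y * centered_sum y ^+ 2 <=
  #|I|%:R + \sum_i \sum_(j | j != i) \sum_y mu y * walsh [set i; j]%SET y.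
Proof.
move=> mu_ge0 mu1.
rewrite (@le_trans _ _ (\sum_y mu y *
  (#|I|%:R + \sum_i \sum_(j | j != i) walsh [set i; j]%SET y))) //.
  by apply: ler_sum => y _; rewrite ler_wpM2l ?centered_sum_sq_le.
under eq_bigr do rewrite mulrDr.
rewrite big_split /= -mulr_suml mu1 mul1r lerD2l.
under eq_bigr do rewrite mulr_sumr.
rewrite exchange_big /=; apply: ler_sum => i _.
under eq_bigr do rewrite mulr_sumr.
by rewrite exchange_big.
Qed.

Lemma second_moment_bernoulli : (0 < #|I|)%N ->
  \sum_y bernoulli_prod y * centered_sum y ^+ 2 <= #|I|%:R.
Proof.
move=> I_gt0.
rewrite (le_trans (second_moment_le _ sum_bernoulli_prod)) //.
  by move=> y; apply/ltW/bernoulli_prod_gt0.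
rewrite big1 ?addr0 // => i _; apply: big1 => j _.
apply: sum_bernoulli_prod_walsh => //; apply/set0Pn.
by exists i; rewrite !inE eqxx.
Qed.

Definition full_state : {ffun I -> bool} := [ffun=> true].

(** The mean of [centered_sum] at time t, starting from [full_state]. *)
Definition mean_full t : R := #|I|%:R * ((1 - p) * (1 - relax_rate) ^+ t).

Lemma walsh_full A : walsh A full_state = (1 - p) ^+ #|A|.
Proof.
rewrite /walsh (eq_bigr (fun=> 1 - p)) ?prodr_const // => i _.
by rewrite ffunE.
Qed.

Lemma mean_transition_pow_full t : (0 < #|I|)%N ->
  \sum_y Pt t full_state y * centered_sum y = mean_full t.
Proof.
move=> I_gt0; under eq_bigr do rewrite centered_sumE mulr_sumr.
rewrite exchange_big /= (eq_bigr (fun=> (1 - p) * (1 - relax_rate) ^+ t)).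
  by rewrite sumr_const -[LHS]mulr_natl.
move=> i _; rewrite sum_transition_pow_walsh // walsh_full.
rewrite /walsh_eigenvalue cards1.
by rewrite mul1r expr1 mulrC.
Qed.

(** Negative correlation: the covariance of two coordinates is proportional to
    (1 - 2 r) ^ t - ((1 - r) ^ 2) ^ t <= 0, where r is the relaxation rate.  Two
    coordinates at least are needed for 0 <= 1 - 2 r. *)
Lemma variance_transition_pow_full t : (1 < #|I|)%N ->
  \sum_y Pt t full_state y * (centered_sum y - mean_full t) ^+ 2 <= #|I|%:R.
Proof.
move=> I_gt1; have I_gt0 := ltnW I_gt1.
have q_gt0 : 0 < 1 - p by rewrite subr_gt0.
rewrite (eq_bigr (fun y => Pt t full_state y * centered_sum y ^+ 2
  - 2 * mean_full t * (Pt t full_state y * centered_sum y)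
  + mean_full t ^+ 2 * Pt t full_state y)) => [|y _]; last by ring.
rewrite !big_split /= sumrN -!mulr_sumr mean_transition_pow_full //.
rewrite sum_transition_pow // mulr1.
suff h : \sum_y Pt t full_state y * centered_sum y ^+ 2 <=
  #|I|%:R + mean_full t ^+ 2 by lra.
rewrite (le_trans (second_moment_le (metropolis_pow_ge0 t _)
  (sum_transition_pow t _ I_gt0))) //.
rewrite lerD2l.
have two_r : 2 * relax_rate <= 1.
  rewrite (@le_trans _ _ (#|I|%:R * #|I|%:R^-1)) //.
    by rewrite ler_pM ?relax_rate_ge0 ?relax_rate_le // ler_nat.
  by rewrite divff // pnatr_eq0 -lt0n.
have bound i j : j != i -> \sum_y Pt t full_state y * walsh [set i; j]%SET y
    <= ((1 - p) * (1 - relax_rate) ^+ t) ^+ 2.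
  move=> ji; have card2 : #|[set i; j]%SET| = 2%N by rewrite cards2 eq_sym ji.
  rewrite sum_transition_pow_walsh // walsh_full /walsh_eigenvalue card2 exprMn.
  rewrite exprAC mulrC ler_wpM2l ?sqr_ge0 // lerXn2r ?nnegrE ?sqr_ge0 //.
    by rewrite subr_ge0.
  rewrite -subr_ge0; have -> : (1 - relax_rate) ^+ 2 - (1 - 2 * relax_rate) =
    relax_rate ^+ 2 by ring.
  exact: sqr_ge0.
rewrite /mean_full exprMn; set u := (X in _ <= _ * X).
have u_ge0 : 0 <= u by apply: sqr_ge0.
rewrite expr2 -mulrA mulr_natl -sumr_const; apply: ler_sum => i _.
rewrite mulr_natl -sumr_const [leRHS](bigD1 i) //=.
rewrite (le_trans (ler_sum _ (bound i))) // lerDr //.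
Qed.

(** The event that [centered_sum] exceeds half of its mean at time t has
    probability at most 4 n / mean ^ 2 at equilibrium, and its complement at
    most that at time t. *)
Lemma metropolis_dist_ge_second_moment t : (1 < #|I|)%N -> 0 < mean_full t ->
  1 - 8 * #|I|%:R / mean_full t ^+ 2 <= metropolis_dist bernoulli_prod t.
Proof.
move=> I_gt1 E_gt0; have I_gt0 := ltnW I_gt1.
apply: le_trans (le_bigmax _ _ full_state).
pose A := [set y | mean_full t / 2 <= centered_sum y]%SET.
apply: le_trans (event_le_tv_dist _ _ A).
have E2_gt0 : 0 < mean_full t / 2 by rewrite divr_gt0.
have hpi : \sum_(y in A) bernoulli_prod y <= #|I|%:R / (mean_full t / 2) ^+ 2.
  rewrite (le_trans (@chebyshev_sum _ _ _ centered_sum 0 _ A E2_gt0 _ _)) //.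
  - by move=> y; apply/ltW/bernoulli_prod_gt0.
  - by move=> y; rewrite inE subr0 => /le_trans; apply; rewrite ler_norm.
  - rewrite ler_pM2r ?invr_gt0 ?exprn_gt0 //.
    by under eq_bigr do rewrite subr0; apply: second_moment_bernoulli.
have hP : \sum_(y in ~: A) Pt t full_state y <=
    #|I|%:R / (mean_full t / 2) ^+ 2.
  rewrite (le_trans (@chebyshev_sum _ _ _ centered_sum (mean_full t) _
    (~: A)%SET E2_gt0 (metropolis_pow_ge0 t _) _)) //.
  - move=> y; rewrite !inE -ltNge => hy; rewrite ler0_norm; lra.
  - by rewrite ler_pM2r ?invr_gt0 ?exprn_gt0 // variance_transition_pow_full.
have := sum_transition_pow t full_state I_gt0; rewrite (bigID (mem A)) /=.
rewrite [X in _ + X](eq_bigl (mem (~: A))); last by move=> y; rewrite !inE.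
have -> : 8 * #|I|%:R / mean_full t ^+ 2 =
    2 * (#|I|%:R / (mean_full t / 2) ^+ 2).
  by field; rewrite gt_eqF.
by move: hpi hP; lra.
Qed.

End ProductBernoulli.

(** * Distance to equilibrium before and after the cutoff time *)

Section CutoffBounds.
Context (R : realType) (p : R) (p_gt0 : 0 < p) (p_lt1 : p < 1) (I : finType).

Local Notation m := (Num.max p (1 - p)).
Local Notation n := (#|I|%:R : R).

Lemma double_relax_rate : 2 * relax_rate p I = (m * n)^-1.
Proof.
rewrite /relax_rate !invfM !mulrA divff ?mul1r //.
Qed.

(** With r the relaxation rate and n the number of coordinates, the point is
    that n (1 - r) ^ (2 t) >= exp (alpha / m - 1).  Since
    1 - r >= exp (- r / (1 - r)), this follows from
    2 t r / (1 - r) <= ln n - alpha / m + 1.  Here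
    2 t r <= ln n - alpha / m by the choice of t, and dividing by 1 - r costs at
    most 1, as n r <= 1 and ln n <= n - 1. *)
Lemma metropolis_dist_before (t : nat) (alpha : R) : (1 < #|I|)%N ->
    0 <= alpha -> t%:R <= m * n * ln n - alpha * n ->
  1 - 8 * expR 1 / (1 - p) ^+ 2 * expR (- (alpha / m)) <=
  metropolis_dist (@bernoulli_prod R p I) t.
Proof.
have -> : 8 * expR 1 / (1 - p) ^+ 2 * expR (- (alpha / m)) =
  8 * (1 - p) ^- 2 * expR (1 - alpha / m) by rewrite expRD; ring.
move=> I_gt1 alpha_ge0 t_le; have I_gt0 := ltnW I_gt1.
have m_gt0 := max_gt0 p_gt0; have q_gt0 : 0 < 1 - p by rewrite subr_gt0.
have n_gt0 : 0 < n by rewrite ltr0n.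
set r := relax_rate p I.
have r_ge0 : 0 <= r := relax_rate_ge0 p_gt0 I.
have nr_le1 : n * r <= 1.
  by rewrite mulrC -ler_pdivlMr // mul1r relax_rate_le.
have n_ge2 : 2 <= n by rewrite ler_nat.
have r_lt1 : 0 < 1 - r by nra.
have L_le : 2 * t%:R * r <= ln n - alpha / m.
  rewrite mulrAC double_relax_rate mulrC ler_pdivrMr ?mulr_gt0 //.
  apply: le_trans t_le _; rewrite le_eqVlt; apply/orP; left; apply/eqP.
  by field; rewrite gt_eqF.
have ln_le : ln n <= n - 1.
  by have := @le_ln1Dx R (n - 1); rewrite [1 + _]addrC subrK; apply; lra.
have am_ge0 : 0 <= alpha / m by rewrite divr_ge0 // ltW.
set L := 2 * t%:R * r in L_le.
have L_ge0 : 0 <= L by rewrite !mulr_ge0.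
have exponent : L / (1 - r) <= ln n - alpha / m + 1.
  rewrite ler_pdivrMr //.
  have : ln n * r <= (n - 1) * r by rewrite ler_wpM2r.
  have : 0 <= alpha / m * r by rewrite mulr_ge0.
  by nra.
have decay : expR (alpha / m - 1) <= n * ((1 - r) ^+ t) ^+ 2.
  have expRr : expR (- (r / (1 - r))) <= 1 - r.
    rewrite expRN -[leRHS]invrK lef_pV2 ?posrE ?expR_gt0 ?invr_gt0 //.
    rewrite (le_trans _ (expR_ge1Dx _)) // le_eqVlt; apply/orP; left.
    by apply/eqP; field; rewrite gt_eqF.
  apply: (@le_trans _ _ (n * (expR (- (r / (1 - r))) ^+ t) ^+ 2)).
    rewrite -!expRM_natl -[X in X * expR _]lnK ?posrE // -expRD ler_expR.
    have -> : 2 * (t%:R * - (r / (1 - r))) = - (L / (1 - r)).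
      by rewrite /L; field; rewrite gt_eqF.
    by move: exponent; lra.
  rewrite ler_wpM2l ?(ltW n_gt0) // lerXn2r ?nnegrE ?exprn_ge0 ?expR_ge0 //.
    exact: ltW.
  by rewrite lerXn2r ?nnegrE ?expR_ge0 // ltW.
have E_gt0 : 0 < mean_full p I t.
  by rewrite /mean_full !mulr_gt0 // exprn_gt0.
apply: le_trans (metropolis_dist_ge_second_moment p_gt0 p_lt1 I_gt1 E_gt0).
rewrite lerD2l lerN2 ler_pdivrMr ?exprn_gt0 //.
rewrite /mean_full -/r.
have -> : 1 - alpha / m = - (alpha / m - 1) by ring.
rewrite expRN; set X := expR _ in decay *.
have X_gt0 : 0 < X by apply: expR_gt0.
have -> : 8 * (1 - p) ^- 2 * X^-1 * (n * ((1 - p) * (1 - r) ^+ t)) ^+ 2 =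
  8 * n * ((n * ((1 - r) ^+ t) ^+ 2) / X) by field; rewrite !gt_eqF.
by rewrite ler_peMr ?mulr_ge0 ?(ltW n_gt0) // ler_pdivlMr // mul1r.
Qed.

(** The time is only known up to rounding down, whence the factor exp (1 / m),
    which bounds exp (1 / (m n)), the effect of one step. *)
Definition chi2_const : R := expR m^-1 / (p * (1 - p)).

(** Put B = [chi2_const].  The chi-square distance is at most exp u - 1 with
    u = B exp (- alpha / m) <= B, and exp u - 1 <= u exp u <= u exp B.  The
    stated bound is the square root of u exp B. *)
Lemma metropolis_dist_after (t : nat) (alpha : R) : (0 < #|I|)%N ->
    0 <= alpha -> m * n * ln n + alpha * n <= t%:R + 1 ->
  metropolis_dist (@bernoulli_prod R p I) t <=
  Num.sqrt (chi2_const * expR chi2_const) * expR (- (alpha / (2 * m))).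
Proof.
move=> I_gt0 alpha_ge0 t_ge.
have m_gt0 := max_gt0 p_gt0; have q_gt0 : 0 < 1 - p by rewrite subr_gt0.
have n_gt0 : 0 < n by rewrite ltr0n.
have n_ge1 : 1 <= n by rewrite ler1n.
set B := chi2_const.
have B_gt0 : 0 < B by rewrite divr_gt0 ?expR_gt0 ?mulr_gt0.
set r := relax_rate p I.
have r_le : 2 * r <= m^-1.
  rewrite double_relax_rate lef_pV2 ?posrE ?mulr_gt0 //.
  by rewrite ler_peMr // ltW.
have exponent : ln n + alpha / m - 2 * r <= 2 * t%:R * r.
  suff : ln n + alpha / m <= (t%:R + 1) * (2 * r) by lra.
  rewrite double_relax_rate ler_pdivlMr ?mulr_gt0 //.
  apply: le_trans _ t_ge; rewrite le_eqVlt; apply/orP; left; apply/eqP.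
  by field; rewrite gt_eqF.
set u := B * expR (- (alpha / m)).
have u_ge0 : 0 <= u by rewrite mulr_ge0 ?expR_ge0 // ltW.
apply: metropolis_dist_le_chi2 => //.
  by rewrite mulr_gt0 ?expR_gt0 // sqrtr_gt0 mulr_gt0 ?expR_gt0.
apply: (@le_trans _ _ (expR u - 1)).
  rewrite lerD2r ler_expR /u /B /chi2_const mulrA [leRHS]mulrAC.
  rewrite ler_pM2r ?invr_gt0 ?mulr_gt0 //.
  rewrite -[X in X * expR _ <= _]lnK ?posrE // -!expRD ler_expR -/r.
  by move: exponent r_le; lra.
rewrite exprMn sqr_sqrtr; last by rewrite mulr_ge0 ?expR_ge0 // ltW.
rewrite -expRM_natl.
have -> : 2 * - (alpha / (2 * m)) = - (alpha / m) by field; rewrite gt_eqF.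
rewrite mulrAC -/u (@le_trans _ _ (u * expR u)) //.
  have := expR_ge1Dx (- u); rewrite expRN => h.
  have : (1 - u) * expR u <= 1.
    by rewrite -ler_pdivlMr ?expR_gt0 // mul1r.
  by lra.
rewrite ler_wpM2l // ler_expR /u ler_piMr ?(ltW B_gt0) //.
by rewrite expR_le1 oppr_le0 divr_ge0 // ltW.
Qed.

End CutoffBounds.

(** * Random graphs as product Bernoulli laws *)

Section ErdosRenyi.
Context (R : realType) (p : R) (nu : nat).

Lemma erdos_renyiE :
  @erdos_renyi R p nu = @bernoulli_prod R p (potential_edge nu).
Proof.
apply/funext => x; pose edges := [pred e | x e].
rewrite /bernoulli_prod (bigID edges) /=.
rewrite (eq_bigr (fun=> p)) => [|e ->//].
rewrite [X in _ * X](eq_bigr (fun=> 1 - p)) => [|e /negbTE ->//].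
rewrite (prodr_const edges) (prodr_const (predC edges)).
have edgesE : edge_count x = #|edges|.
  rewrite -sum1_card /edge_count [RHS]big_mkcond; apply: eq_bigr => e _.
  by rewrite inE; case: (x e).
by rewrite /erdos_renyi edgesE -card_potential_edge -(cardC edges) addKn.
Qed.

End ErdosRenyi.

(** * Limits *)

Section ExtendedLimits.
Context (R : realType).
Implicit Types u : nat -> \bar R.
Local Open Scope classical_set_scope.
Local Open Scope ereal_scope.

Lemma limn_esup_le u (b : \bar R) : (\forall k \near \oo, u k <= b) ->
  limn_esup u <= b.
Proof.
move=> ub; rewrite /limn_esup /limf_esup.
apply: (@le_trans _ _ (ereal_sup (u @` [set k | u k <= b]))).
  by apply: ereal_inf_lbound; exists [set k | u k <= b].
by apply: ge_ereal_sup => _ [k kb <-].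
Qed.

Lemma limn_esup_ge u (b : \bar R) : (\forall k \near \oo, b <= u k) ->
  b <= limn_esup u.
Proof.
move=> bu; rewrite /limn_esup /limf_esup.
apply: le_ereal_inf_tmp => _ [A Aoo <-].
have [k [Ak bk]] : exists k, A k /\ b <= u k.
  have : \forall k \near \oo, A k /\ b <= u k by near=> k; split; near: k.
  by move=> [N _ /(_ N (leqnn N))]; exists N.
by apply: le_trans bk _; apply: ereal_sup_ubound; exists k.
Unshelve. all: by end_near. Qed.

Lemma limn_einf_ge u (b : \bar R) : (\forall k \near \oo, b <= u k) ->
  b <= limn_einf u.
Proof.
move=> bu; rewrite /limn_einf leeNr; apply: limn_esup_le.
by apply: filterS bu => k; rewrite leeN2.
Qed.

Lemma limn_einf_le u (b : \bar R) : (\forall k \near \oo, u k <= b) ->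
  limn_einf u <= b.
Proof.
move=> bu; rewrite /limn_einf leeNl; apply: limn_esup_ge.
by apply: filterS bu => k; rewrite leeN2.
Qed.

End ExtendedLimits.

Section Divergence.
Context (R : realType).
Local Open Scope classical_set_scope.

Lemma leq_bin2 nu : (nu <= 'C(nu.+1, 2))%N.
Proof. by rewrite binS bin1 leq_addl. Qed.

Lemma near_bin2_ge N : \forall nu \near \oo, (N <= 'C(nu, 2))%N.
Proof.
exists N.+1 => // -[//|nu]; rewrite /= ltnS => N_le.
exact: leq_trans N_le (leq_bin2 nu).
Qed.

Lemma near_ln_bin2_ge (M : R) :
  \forall nu \near \oo, M <= ln ('C(nu, 2)%:R : R).
Proof.
apply: filterS (near_bin2_ge (Num.truncn (expR M)).+1) => nu large.
have M_lt : expR M < 'C(nu, 2)%:R.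
  by rewrite (lt_le_trans (truncnS_gt _)) // ler_nat.
rewrite -[M]expRK ler_ln ?posrE ?expR_gt0 ?(ltW M_lt) //.
by rewrite (lt_trans _ M_lt) ?expR_gt0.
Qed.

Lemma cvg_exp_decay (a b c : R) : 0 < c ->
  (a + b * expR (- (alpha * c)))%:E @[alpha --> +oo%R] --> a%:E.
Proof.
move=> c_gt0; apply: cvg_EFin; first exact: nearW.
have decay : expR (- (alpha * c)) @[alpha --> +oo] --> (0 : R^o).
  apply: (@cvg_comp _ _ _ (fun alpha => alpha * c) (fun x => expR (- x))).
    by apply: gt0_cvgMly.
  exact: cvgr_expR.
rewrite -[X in _ --> X]addr0 -(mulr0 b).
by apply: cvgD; [exact: cvg_cst | apply: cvgM => //; exact: cvg_cst].
Qed.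

End Divergence.

(* The terms nu = 0, 1 do not affect the limits in nu. *)
Theorem corollary2 (R : realType) (p : R) (p_gt0 : 0 < p) (p_lt1 : p < 1) :
  has_cutoff
    (fun nu t : nat => metropolis_dist (@erdos_renyi R p nu) t)
    (fun nu : nat => Num.max p (1 - p) * 'C(nu, 2)%:R * ln ('C(nu, 2)%:R : R))
    (fun nu : nat => 'C(nu, 2)%:R).
Proof.
have m_gt0 : 0 < Num.max p (1 - p) by exact: max_gt0.
have minv_gt0 : 0 < (Num.max p (1 - p))^-1 by rewrite invr_gt0.
split.
- apply/eqoP => e e_gt0.
  apply: filterS (near_ln_bin2_ge (e * Num.max p (1 - p))^-1) => nu large.
  rewrite ger0_norm // (le_trans _ (ler_wpM2l (ltW e_gt0) (ler_norm _))) //.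
  rewrite [leRHS](_ : _ = 'C(nu, 2)%:R *
    (e * Num.max p (1 - p) * ln ('C(nu, 2)%:R : R))); last by ring.
  by rewrite ler_peMr // mulrC -ler_pdivrMr ?mulr_gt0 // mul1r.
- apply: (squeeze_cvge (f := fun alpha => (1 + - (8 * expR 1 / (1 - p) ^+ 2) *
      expR (- (alpha * (Num.max p (1 - p))^-1)))%:E) (h := cst 1%:E)).
  + near=> alpha; apply/andP; split; last first.
      apply: limn_einf_le; apply: filterS (near_bin2_ge 1) => nu n_gt0.
      by rewrite lee_fin erdos_renyiE metropolis_dist_le1 ?card_potential_edge.
    apply: limn_einf_ge; near=> nu.
    rewrite lee_fin erdos_renyiE mulNr.
    have -> : 'C(nu, 2) = #|potential_edge nu| by rewrite card_potential_edge.
    apply: metropolis_dist_before => //.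
    * by rewrite card_potential_edge; near: nu; exact: near_bin2_ge.
    (* Rounding down is an upper bound only for a nonnegative time: here n has
       to be large depending on alpha. *)
    * rewrite truncn_le card_potential_edge subr_ge0 mulrAC ler_wpM2r //.
      rewrite mulrC -ler_pdivrMr //; near: nu; exact: near_ln_bin2_ge.
  + exact: cvg_exp_decay.
  + exact: cvg_cst.
- apply: (squeeze_cvge (f := cst 0%:E) (h := fun alpha => (0 +
      Num.sqrt (chi2_const p * expR (chi2_const p)) *
      expR (- (alpha * (2 * Num.max p (1 - p))^-1)))%:E)).
  + near=> alpha; apply/andP; split.
      apply: limn_esup_ge; apply: nearW => nu.
      by rewrite lee_fin erdos_renyiE metropolis_dist_ge0.
    apply: limn_esup_le; near=> nu.
    rewrite lee_fin erdos_renyiE add0r.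
    have -> : 'C(nu, 2) = #|potential_edge nu| by rewrite card_potential_edge.
    apply: metropolis_dist_after => //.
    * by rewrite card_potential_edge; near: nu; exact: near_bin2_ge.
    * by rewrite natr1 ltW // truncnS_gt.
  + exact: cvg_cst.
  + by apply: cvg_exp_decay; rewrite invr_gt0 mulr_gt0.
Unshelve. all: by end_near.
Qed.
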